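(* Let $M,k\ge1$, let $I_M=\{1,\dots,M\}$, and let $\mathcal K$ be a linear operator on the space $L(I_M,\mathbb C^k)$ of functions $I_M\to\mathbb C^k$, with $M\times M$ block matrix $\mathbf K\in\mathbb C^{kM\times kM}$ having $k\times k$ blocks $\mathbf K(n,m)$, $n,m\in I_M$. For each $n$, each $\mathbf j\in J_k^{(n)}=\{(j_1,\dots,j_n):1\le j_\alpha\le k\ \forall\alpha\}$ and each $\mathbf m\in\mathcal M_M^{(n)}=\{(m_1,\dots,m_n):1\le m_\alpha\le M\ \forall\alpha\}$ define $$\widetilde K^{(n)}_{\mathbf j}(\mathbf m):=\det\left[[\mathbf K(m_\alpha,m_\beta)]_{j_\alpha j_\beta}(1-\delta_{\alpha\beta})\right]_{\alpha,\beta=1}^n .$$ Then for all $z\in\mathbb C$ the 2-modified Fredholm determinant ${\det}_2(\mathcal I+z\mathcal K)$ is given by $${\det}_2(\mathbf I+z\mathbf K)=e^{-z\operatorname{Tr}(\mathbf K)}\det(\mathbf I+z\mathbf K)=\sum_{n=0}^\infty\frac{z^n}{n!}\sum_{\mathbf j\in J_k^{(n)}}\sum_{\mathbf m\in\mathcal M_M^{(n)}}\widetilde K^{(n)}_{\mathbf j}(\mathbf m).$$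
   Context: $L(I_M,\mathbb C^k)$ has inner product $\langle\phi,\psi\rangle=\sum_{m=1}^M\langle\phi(m),\psi(m)\rangle_{\mathbb C^k}$ (conjugate linear in the first slot) and orthonormal basis $\phi_{m,j}(\ell):=\delta_{m\ell}\mathbf e_j$, $1\le m\le M$, $1\le j\le k$. The $k\times k$ matrix $\mathbf K(n,m)$ has entries $[\mathbf K(n,m)]_{i,j}=\langle\phi_{n,i},\mathcal K\phi_{m,j}\rangle$, so that $(\mathcal K\phi)(n)=\sum_{m=1}^M\mathbf K(n,m)\phi(m)$; $\mathbf K$ is the block matrix with $(n,m)$ block $\mathbf K(n,m)$. $\delta_{\alpha\beta}$ is the Kronecker delta. The 2-modified Fredholm determinant of a Hilbert-Schmidt operator is ${\det}_2(\mathcal I+z\mathcal K):={\det}_1[(\mathcal I+z\mathcal K)\exp(-z\mathcal K)]$, where ${\det}_1(\mathcal I+\mathcal T):=\sum_{n\ge0}\operatorname{Tr}(\wedge^n\mathcal T)$ for trace class $\mathcal T$ (in finite dimensions ${\det}_1$ is the ordinary determinant). The $n=0$ term of the series equals $1$. *)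

(* Defs.v *)
From mathcomp Require Import all_boot all_order all_algebra.
From mathcomp Require Import all_classical all_reals all_analysis.
From mathcomp Require Import complex.

Set Implicit Arguments.
Unset Strict Implicit.
Unset Printing Implicit Defensive.

Import Order.TTheory GRing.Theory Num.Theory.
Import numFieldNormedType.Exports.

Local Open Scope classical_set_scope.
Local Open Scope ring_scope.

(* The complex numbers, packed as a numClosedFieldType: R[i] by itself carries
   no topology, whereas the carrier of a packed numClosedFieldType inherits the
   topology of its norm. *)
Definition Cplx (R : realType) : numClosedFieldType := R[i].

Definition cexp (R : realType) (w : Cplx R) : Cplx R :=
  limn (series (fun n : nat => w ^+ n / n`!%:R)).

Definition expmx (R : realType) (d : nat) (A : 'M[Cplx R]_d) : 'M[Cplx R]_d :=
  limn (series (fun n : nat => (n`!%:R)^-1 *: (A ^+ n))).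

(* det_2(I + T) as a function of T. *)
Definition det2mx (R : realType) (d : nat) (T : 'M[Cplx R]_d) : Cplx R :=
  \det ((1%:M + T) *m expmx (- T)).

(* L(I_M, C^k). Indices start at 0: 'I_M stands for {1, ..., M}, 'I_k for
   {1, ..., k}. *)
Notation funsp R M k := {ffun 'I_M -> 'cV[Cplx R]_k}.

Section Operators.
Variables (R : realType) (M k : nat).
Local Notation C := (Cplx R).
Local Notation L := (funsp R M k).

Definition dotC (u v : 'cV[C]_k) : C := \sum_(i < k) (u i 0)^* * v i 0.

Definition dotL (phi psi : L) : C := \sum_(m < M) dotC (phi m) (psi m).

Definition basisL (m : 'I_M) (j : 'I_k) : L :=
  [ffun l => (m == l)%:R *: delta_mx j 0].

Definition block (K : 'End(L)) (n m : 'I_M) : 'M[C]_k :=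
  \matrix_(i, j) dotL (basisL n i) (K (basisL m j)).

Definition blockmx (K : 'End(L)) : 'M[C]_(\sum_(n < M) k) :=
  \mxblock_(n < M, m < M) block K n m.

(* exp(T) phi = \sum_n T^n phi / n!, evaluated at each point of I_M; linfun
   packs this function, which is linear, as an endomorphism. *)
Definition expop (T : 'End(L)) : 'End(L) :=
  linfun (fun phi : L => [ffun m : 'I_M =>
    limn (series (fun n : nat => (n`!%:R)^-1 *: (iter n T phi : L) m))] : L).

(* Determinant of an endomorphism of a finite-dimensional space, i.e. of its
   matrix in a basis; the value does not depend on the basis. *)
Definition det1op (A : 'End(L)) : C :=
  \det (passmx.mxof (vbasis {:L}) (vbasis {:L}) A).

(* det_2(I + T) as a function of T. *)
Definition det2op (T : 'End(L)) : C := det1op ((\1 + T) \o expop (- T))%VF.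

Definition Ktilde (K : 'End(L)) (n : nat)
    (j : n.-tuple 'I_k) (m : n.-tuple 'I_M) : C :=
  \det (\matrix_(a < n, b < n)
    (block K (tnth m a) (tnth m b) (tnth j a) (tnth j b) * (1 - (a == b)%:R))).

End Operators.

(* Main.v *)
Require Import Defs.
From HB Require Import structures.
From mathcomp Require Import all_boot all_order all_algebra.
From mathcomp Require Import perm.
From mathcomp Require Import all_classical all_reals all_analysis.
From mathcomp Require Import complex ring.

(* Triangularizing A gives det (exp A) = exp (tr A), whence the closed form
   det_2(I + zK) = exp(- z tr K) det(I + zK).

   For the series, let D_n be the sum of det [A(f a, f b)] over all n-tuples f
   of indices. Only injective tuples contribute, and each principal minor of
   size n is hit n! times, so det(I + zA) = \sum_n z^n D_n / n!. Zeroing the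
   diagonal entries one at a time, each by linearity of the determinant in one
   row, shows that the sums with hollow diagonal are
   \sum_i 'C(n, i) (- tr A)^i D_(n-i). Hence the series of the theorem is the
   Cauchy product of the series of exp(- z tr A) with the polynomial
   det(I + zA). *)

Set Implicit Arguments.
Unset Strict Implicit.
Unset Printing Implicit Defensive.

Import Order.TTheory GRing.Theory Num.Theory.
Import numFieldNormedType.Exports.

Local Open Scope ring_scope.

(** * Sums of minors over tuples of indices *)

Section TupleMinors.
Variables (C : comPzRingType) (I : finType) (A : I -> I -> C).

Definition minor_sum n : C :=
  \sum_(f : {ffun 'I_n -> I}) \det (\matrix_(a, b) A (f a) (f b)).

(* hollow_sum n n is the sum of the paper's determinants; letting the number s of
   zeroed diagonal entries vary connects it to minor_sum by induction. *)
Definition hollow_sum n s : C :=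
  \sum_(f : {ffun 'I_n -> I})
    \det (\matrix_(a, b) (A (f a) (f b) * (1 - ((a == b) && (a < s)%N)%:R))).

(** Inserting a value at position [p] is a bijection from pairs of an index and an [n]-tuple onto
    [n.+1]-tuples; this factors out the trace in [hollow_sumS]. *)
Lemma sum_ffun_ins n (p : 'I_n.+1) (F : I -> C) (G : {ffun 'I_n -> I} -> C) :
  \sum_(f : {ffun 'I_n.+1 -> I}) F (f p) * G [ffun a => f (lift p a)] =
  (\sum_x F x) * (\sum_g G g).
Proof.
rewrite big_distrlr pair_bigA /=.
rewrite (reindex (fun xg : I * {ffun 'I_n -> I} =>
  [ffun a => if unlift p a is Some b then xg.2 b else xg.1])) /=.
  apply: eq_bigr => -[x g] _ /=; rewrite ffunE unlift_none; congr (_ * G _).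
  by apply/ffunP => a; rewrite !ffunE liftK.
exists (fun f : {ffun 'I_n.+1 -> I} => (f p, [ffun a => f (lift p a)])) => f _.
  case: f => x g /=; rewrite ffunE unlift_none; congr pair.
  by apply/ffunP => a; rewrite !ffunE liftK.
by apply/ffunP => a; rewrite ffunE /=; case: unliftP => [b|] -> //; rewrite ffunE.
Qed.

(** Laplace expansion along row [p] leaves only the diagonal cofactor, whose sign (-1)^(2p) is 1. *)
Lemma det_row_delta n (M : 'M[C]_n) p c :
  (forall b, M p b = c * (p == b)%:R) -> \det M = c * \det (row' p (col' p M)).
Proof.
move=> Mp; rewrite (expand_det_row M p) (bigD1 p) //= big1 => [|b nbp].
  by rewrite addr0 Mp eqxx mulr1 /cofactor addnn -signr_odd odd_double mul1r.
by rewrite Mp eq_sym (negPf nbp) mulr0 mul0r.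
Qed.

(** Row [s] is split by linearity: zeroing its diagonal entry subtracts [P], whose row [s] keeps
    that entry alone. Deleting row and column [s] fixes the positions below [s], so [s] zeroed
    entries remain. *)
Lemma hollow_sumS n s : (s <= n)%N ->
  hollow_sum n.+1 s.+1 = hollow_sum n.+1 s - (\sum_x A x x) * hollow_sum n s.
Proof.
move=> le_sn; pose p : 'I_n.+1 := Ordinal (le_sn : (s < n.+1)%N).
rewrite -(sum_ffun_ins p) -sumrB; apply: eq_bigr => f _.
set M' := \matrix_(a, b) _; set M := \matrix_(a, b) _; set N := \matrix_(a, b) _.
pose P : 'M[C]_n.+1 := \matrix_(a, b)
  (if a == p then A (f p) (f p) * (p == b)%:R else M a b).
have ltSp a : a != p -> (a < s.+1)%N = (a < s)%N.
  by rewrite -val_eqE /= ltnS [RHS]ltn_neqAle => ->.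
have nlp a : (lift p a == p) = false by apply: negbTE; rewrite eq_sym neq_lift.
rewrite (@determinant_multilinear _ _ M' M P p 1 (-1)) ?mul1r ?mulN1r.
- congr (_ - _); rewrite (@det_row_delta _ P p (A (f p) (f p))); last first.
    by move=> b; rewrite mxE eqxx.
  congr (_ * \det _); apply/matrixP => a b; rewrite !mxE nlp.
  rewrite !ffunE (inj_eq lift_inj) /= /bump; case: (leqP s a) => /= le_sa.
    by rewrite add1n ltnNge leqW.
  by rewrite add0n le_sa.
- apply/rowP => b; rewrite !mxE eqxx ltnS leqnn ltnn andbT andbF subr0.
  rewrite !mul1r mulN1r !mulr1.
  by rewrite mulrBr mulr1; case: eqP => [<-|] //; rewrite !mulr0.
- by apply/matrixP => a b; rewrite !mxE ltSp ?nlp.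
- by apply/matrixP => a b; rewrite !mxE nlp ltSp ?nlp.
Qed.

Lemma hollow_sum0 n : hollow_sum n 0 = minor_sum n.
Proof.
apply: eq_bigr => f _; congr (\det _); apply/matrixP => a b.
by rewrite !mxE andbF subr0 mulr1.
Qed.

(** Induction on [s]: the recursion [hollow_sumS] turns into Pascal's rule. *)
Lemma hollow_sumE n s : (s <= n)%N ->
  hollow_sum n s =
  \sum_(i < s.+1) (- \sum_x A x x) ^+ i * minor_sum (n - i) *+ 'C(s, i).
Proof.
elim: s n => [|s IHs] [|n] // le_sn.
- by rewrite big_ord1 hollow_sum0 expr0 mul1r.
- by rewrite big_ord1 hollow_sum0 expr0 mul1r.
rewrite hollow_sumS // !IHs //; last exact: leqW.
set t := \sum_x A x x; pose g i := (- t) ^+ i * minor_sum (n.+1 - i).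
transitivity (\sum_(i < s.+2) g i *+ 'C(s, i) + \sum_(i < s.+1) g i.+1 *+ 'C(s, i)).
  rewrite [in RHS]big_ord_recr /= bin_small // mulr0n addr0 -mulNr mulr_sumr.
  congr (_ + _); apply: eq_bigr => i _.
  by rewrite /g subSS exprS -mulrnAr mulrA mulrnAr.
rewrite [in RHS]big_ord_recl [X in X + _ = _]big_ord_recl /= !bin0 -addrA.
rewrite -big_split /=.
by congr (_ + _); apply: eq_bigr => i _; rewrite /bump /= add1n binS mulrnDr.
Qed.
End TupleMinors.

(** * Principal minors and the coefficients of det(I + zA) *)

Section PrincipalMinors.
Variable C : comPzRingType.

(* Replacing the rows outside S by rows of the identity yields the principal
   minor on S without reindexing; see pminor_inj. *)
Definition pminor d (S : {set 'I_d}) (A : 'M[C]_d) : C :=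
  \det (\matrix_(i, j) if i \in S then A i j else (i == j)%:R).

(** Each factor in the Leibniz formula is an entry of [A] plus one of the identity; distributing the
    product chooses the set [S] of rows taken from [A]. *)
Lemma det1DE d (A : 'M[C]_d) :
  \det (1%:M + A) = \sum_(S : {set 'I_d}) pminor S A.
Proof.
rewrite /pminor exchange_big /=; apply: eq_bigr => s _.
rewrite -mulr_sumr; congr (_ * _).
under eq_bigr do rewrite !mxE addrC.
rewrite bigA_distr; apply: eq_bigr => S _; apply: eq_bigr => i _.
by rewrite mxE.
Qed.

Lemma pminorZ d (S : {set 'I_d}) z (A : 'M[C]_d) :
  pminor S (z *: A) = z ^+ #|S| * pminor S A.
Proof.
have -> : z ^+ #|S| = \det (diag_mx (\row_i (if i \in S then z else 1))).
  rewrite det_diag -prodr_const [LHS]big_mkcond.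
  by apply: eq_bigr => i _; rewrite mxE.
rewrite -det_mulmx; congr (\det _); apply/matrixP => i j.
by rewrite mul_diag_mx !mxE; case: ifP; rewrite ?mul1r.
Qed.

(** Induction on [d]. If [f] is onto, it is a permutation and the signs from rows and columns
    cancel. Otherwise an index missed by [f] has an identity row; deleting that row and its column
    lowers [d]. *)
Lemma pminor_inj d p (f : 'I_p -> 'I_d) (A : 'M[C]_d) : injective f ->
  \det (\matrix_(a, b) A (f a) (f b)) = pminor [set f a | a in 'I_p] A.
Proof.
elim: d => [|d IHd] in p f A *.
  case: p f => [|p] f; last by case: (f ord0).
  by rewrite /pminor !det_mx00.
move=> f_inj; set S := [set _ | _ in _].
have [fullS|] := eqVneq S [set: 'I_d.+1].
  have eq_p : p = d.+1.
    by rewrite -[p]card_ord -(card_imset _ f_inj) -/S fullS cardsT card_ord.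
  subst p; pose s := perm f_inj.
  rewrite (_ : \matrix_(a, b) _ = row_perm s (col_perm s A)); last first.
    by apply/matrixP => a b; rewrite !mxE !permE.
  rewrite row_permE col_permE !det_mulmx !det_perm odd_permV mulrCA.
  rewrite -signr_addb addbb mulr1; congr (\det _).
  by apply/matrixP => i j; rewrite !mxE fullS inE.
rewrite -properT => /properP[_ [i0 _ Si0]].
have fi0 a : i0 != f a.
  by apply: contraNneq Si0 => ->; apply: imset_f.
have [g fE] : exists g : 'I_p -> 'I_d, forall a, f a = lift i0 (g a).
  by exists (fun a => s2val (unlift_some (fi0 a))) => a; case: unlift_some.
rewrite (_ : \matrix_(a, b) _ =
  \matrix_(a, b) (row' i0 (col' i0 A)) (g a) (g b)); last first.
  by apply/matrixP => a b; rewrite !mxE !fE.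
have g_inj : injective g by move=> a b gab; apply: f_inj; rewrite !fE gab.
rewrite IHd // /pminor [RHS](det_row_delta (p := i0) (c := 1)); last first.
  by move=> b; rewrite mxE (negPf Si0) mul1r.
rewrite mul1r; congr (\det _); apply/matrixP => i j; rewrite !mxE (inj_eq lift_inj).
congr (if _ then _ else _); rewrite /S (eq_imset _ fE) (imset_comp (lift i0) g).
by rewrite mem_imset //; apply: lift_inj.
Qed.

(** A repeated index gives two equal rows, hence 0. Injective tuples are grouped by image, and a set
    of [p] elements is the image of p! of them. *)
Lemma minor_sumE d (A : 'M[C]_d) p :
  minor_sum A p = (\sum_(S : {set 'I_d} | #|S| == p) pminor S A) *+ p`!.
Proof.
rewrite /minor_sum (bigID (fun f : {ffun _} => injectiveb f)) /= addrC big1 ?add0r.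
  rewrite (partition_big (fun f : {ffun 'I_p -> 'I_d} => [set f a | a in 'I_p])
    (fun S => #|S| == p)) /=; last first.
    by move=> f /injectiveP f_inj; rewrite card_imset // card_ord.
  rewrite -sumrMnl; apply: eq_bigr => S /eqP cardS.
  transitivity (\sum_(f : {ffun 'I_p -> 'I_d} |
      injectiveb f && ([set f a | a in 'I_p] == S)) pminor S A).
    by apply: eq_bigr => f /andP[/injectiveP f_inj /eqP <-]; apply: pminor_inj.
  rewrite sumr_const; congr (_ *+ _).
  rewrite -ffactnn -[in X in X ^_ _]cardS -[in X in _ ^_ X](card_ord p).
  rewrite -card_inj_ffuns_on; apply: eq_card => f; rewrite [in RHS]inE [RHS]andbC.
  apply: andb_id2l => /injectiveP f_inj; apply/eqP/ffun_onP => [<- a|fS].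
    exact: imset_f.
  apply/eqP; rewrite eqEcard card_imset // card_ord cardS leqnn andbT.
  by apply/fintype.subsetP => _ /imsetP[a _ ->]; apply: fS.
move=> f /injectivePn[a [b neq_ab eq_f]].
by rewrite (determinant_alternate neq_ab) // => c; rewrite !mxE eq_f.
Qed.

Lemma det1DZ d (A : 'M[C]_d) z :
  \det (1%:M + z *: A) =
  \sum_(p < d.+1) z ^+ p * \sum_(S : {set 'I_d} | #|S| == p) pminor S A.
Proof.
(* [inord] loses nothing, since #|S| is at most [d]. *)
rewrite det1DE (partition_big (fun S : {set 'I_d} => inord #|S| : 'I_d.+1) xpredT) //=.
apply: eq_bigr => p _; rewrite mulr_sumr; apply: eq_big => [S|S].
  by rewrite -val_eqE /= inordK // ltnS -[X in (_ <= X)%N]card_ord max_card.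
by move/eqP<-; rewrite pminorZ inordK // ltnS -[X in (_ <= X)%N]card_ord max_card.
Qed.
End PrincipalMinors.

(** * The complex exponential *)

Local Open Scope classical_set_scope.

Lemma big_cauchy_triangle (V : nmodType) N (F : nat -> nat -> V) :
  \sum_(n < N) \sum_(i < n.+1) F i (n - i)%N =
  \sum_(i < N) \sum_(j < (N - i)%N) F i j.
Proof.
elim: N => [|N IHN]; first by rewrite !big_ord0.
rewrite big_ord_recr /= IHN big_ord_recr /= [in RHS]big_ord_recr /= addrA.
rewrite subnn subSn // subnn big_ord1 -big_split /=; congr (_ + _).
by apply: eq_bigr => i _; rewrite subSn 1?ltnW // big_ord_recr.
Qed.

Lemma exprD_div_fact (K : numFieldType) (a b : K) n :
  (a + b) ^+ n / n`!%:R =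
  \sum_(i < n.+1) (a ^+ i / i`!%:R) * (b ^+ (n - i) / (n - i)`!%:R).
Proof.
rewrite addrC exprDn mulr_suml; apply: eq_bigr => i _.
have le_in : (i <= n)%N by rewrite -ltnS.
have nz k : k`!%:R != 0 :> K by rewrite pnatr_eq0 -lt0n fact_gt0.
have nzb : 'C(n, i)%:R != 0 :> K by rewrite pnatr_eq0 -lt0n bin_gt0.
rewrite -mulr_natr -(bin_fact le_in) !natrM.
by field; rewrite !nz nzb.
Qed.

(** The product of partial sums ranges over the square i, j < N, the partial sum at [a + b] over the
    triangle i + j < N. *)
Lemma exp_series_mulB (K : numFieldType) (a b : K) N :
  (series (fun n => a ^+ n / n`!%:R) N) * (series (fun n => b ^+ n / n`!%:R) N) -
  series (fun n => (a + b) ^+ n / n`!%:R) N =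
  \sum_(i < N) \sum_(j < N | ~~ (i + j < N)%N)
    (a ^+ i / i`!%:R) * (b ^+ j / j`!%:R).
Proof.
rewrite /series /= !big_mkord; under [X in _ - X]eq_bigr do rewrite exprD_div_fact.
rewrite (big_cauchy_triangle N (fun i j => (a ^+ i / i`!%:R) * (b ^+ j / j`!%:R))).
rewrite big_distrlr -sumrB; apply: eq_bigr => i _ /=.
rewrite (bigID (fun j : 'I_N => (i + j < N)%N)) /= addrC.
rewrite (big_ord_widen N (fun j => (a ^+ i / i`!%:R) * (b ^+ j / j`!%:R))) ?leq_subr //.
by under [X in _ - X]eq_bigl do rewrite ltn_subRL; rewrite addrK.
Qed.

Section ComplexExponential.
Variable R : realType.
Local Notation C := (Cplx R).
Local Notation toC := (real_complex R : R -> C).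

Lemma norm_toC (x : R) : `|toC x| = toC `|x|.
Proof. by rewrite normc_def /= expr0n addr0 sqrtr_sqr. Qed.

Lemma norm_le_ReIm (z : C) : `|z| <= toC (`|complex.Re z| + `|complex.Im z|).
Proof.
rewrite rmorphD /= -!norm_toC [in leLHS](complexE z).
rewrite (le_trans (ler_normD _ _)) // normrM.
by rewrite [X in X * _](_ : _ = 1) ?mul1r // normc_def /= expr0n expr1n add0r sqrtr1.
Qed.

(** The order on complex numbers makes positive elements real, so every epsilon can be taken
    real. *)
Lemma gt0_toC (e : C) : 0 < e -> exists2 r : R, 0 < r & e = toC r.
Proof.
case: e => r i; rewrite ltcE /= => /andP[/eqP-> r0]; by exists r.
Qed.

Lemma norm_toCE (z : C) : exists2 r : R, 0 <= r & `|z| = toC r.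
Proof.
exists (complex.Re `|z|); last by rewrite RRe_real // normr_real.
by rewrite -ler0c RRe_real ?normr_real.
Qed.

Lemma cvg_complex (u : nat -> C) (l : C) :
  (fun n => complex.Re (u n)) @ \oo --> complex.Re l ->
  (fun n => complex.Im (u n)) @ \oo --> complex.Im l -> u @ \oo --> l.
Proof.
move=> /cvgrPdist_lt cRe /cvgrPdist_lt cIm; apply/cvgrPdist_lt => _ /gt0_toC[e e0 ->].
have e2 : 0 < e / 2 by rewrite divr_gt0.
near=> n.
rewrite (le_lt_trans (norm_le_ReIm _)) // ltcR [e]splitr !raddfB /=.
by rewrite ltrD //; near: n; [apply: cRe | apply: cIm].
Unshelve. all: by end_near. Qed.

Lemma ReIm_le_norm (z : C) (r : R) : `|z| <= toC r ->
  `|complex.Re z| <= r /\ `|complex.Im z| <= r.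
Proof.
rewrite normc_def lecR => zr; split; apply: le_trans zr.
  by rewrite -sqrtr_sqr ler_wsqrtr // lerDl sqr_ge0.
by rewrite -sqrtr_sqr ler_wsqrtr // lerDr sqr_ge0.
Qed.

Lemma series_le_cvg_complex (u : nat -> C) (v : nat -> R) :
  (forall n, `|u n| <= toC (v n)) -> cvgn (series v) -> cvgn (series u).
Proof.
move=> uv cv.
have v0 n : 0 <= v n by have := le_trans (normr_ge0 _) (uv n); rewrite ler0c.
have cR (f : C -> R) : (forall n, `|f (u n)| <= v n) -> cvgn (series (f \o u)).
  move=> fv; apply: normed_cvg; apply: series_le_cvg cv => //= n.
have := cR (@complex.Re R) (fun n => (ReIm_le_norm (uv n)).1).
have := cR (@complex.Im R) (fun n => (ReIm_le_norm (uv n)).2).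
move=> /cvg_ex[b cb] /cvg_ex[a ca]; apply/cvg_ex; exists (Complex a b).
apply: cvg_complex => /=.
  by under eq_fun do rewrite /series /= raddf_sum.
by under eq_fun do rewrite /series /= raddf_sum.
Qed.

(** Comparison with the real exponential series at [c]. A general [u] covers both powers of a number
    and entries of matrix powers. *)
Lemma cvg_cexp_coeff (u : nat -> C) (c : R) :
  (forall n, `|u n| <= toC (c ^+ n)) -> cvgn (series (fun n => u n / n`!%:R)).
Proof.
move=> uc; apply: series_le_cvg_complex (is_cvg_series_exp_coeff c) => n.
rewrite normrM normfV normr_nat /exp_coeff /= rmorphM /= fmorphV rmorph_nat.
by rewrite ler_wpM2r // invr_ge0 ler0n.
Qed.

Lemma cexp_cvg (w : C) : series (fun n => w ^+ n / n`!%:R) @ \oo --> cexp w.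
Proof.
have [r _ wr] := norm_toCE w.
by apply: (@cvg_cexp_coeff _ r) => n; rewrite normrX wr rmorphXn.
Qed.

(* The error of the product of partial sums is a sum of monomials in a and b, so
   it is dominated by the same error at |a|, |b|, which tends to 0 because the
   real exponential is multiplicative. *)
Lemma cexpD (a b : C) : cexp (a + b) = cexp a * cexp b.
Proof.
have [r r0 ar] := norm_toCE a; have [t t0 bt] := norm_toCE b.
pose E (K : numFieldType) (x : K) := series (fun n => x ^+ n / n`!%:R).
have ER (x : R) N : toC (E R x N) = E C (toC x) N.
  rewrite /E /series /= rmorph_sum; apply: eq_bigr => i _.
  by rewrite rmorphM /= fmorphV rmorphXn rmorph_nat.
have bnd N : `|E C a N * E C b N - E C (a + b) N| <=
    toC (E R r N * E R t N - E R (r + t) N).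
  rewrite rmorphB rmorphM /= !ER rmorphD /= !exp_series_mulB -ar -bt.
  rewrite (le_trans (ler_norm_sum _ _ _)) // ler_sum // => i _.
  rewrite (le_trans (ler_norm_sum _ _ _)) // ler_sum // => j _.
  by rewrite !normrM !normfV !normr_nat !normrX.
have cD : (fun N => E R r N * E R t N - E R (r + t) N) @ \oo --> (0 : R).
  rewrite -(subrr (expR (r + t))) {1}expRD.
  by apply: cvgB; [apply: cvgM|]; apply: is_cvg_series_exp_coeff.
have c0 : (fun N => E C a N * E C b N - E C (a + b) N) @ \oo --> (0 : C).
  apply/cvgr0Pnorm_lt => _ /gt0_toC[e e0 ->].
  move/cvgr0Pnorm_lt : cD => /(_ e e0); apply: filterS => N lt_e.
  by rewrite (le_lt_trans (bnd N)) // ltcR (le_lt_trans (ler_norm _)).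
have c1 : (fun N => E C a N * E C b N - E C (a + b) N) @ \oo -->
    cexp a * cexp b - cexp (a + b).
  by apply: cvgB; [apply: cvgM|]; apply: cexp_cvg.
by apply/esym/eqP; rewrite -subr_eq0; apply/eqP; apply: cvg_unique c1 c0.
Qed.

Lemma cexp0 : cexp 0 = 1 :> C.
Proof.
(* The partial sums equal 1 only from index 1 on, the one at index 0 being empty; hence the
   shift. *)
apply/cvg_lim => //; rewrite -(cvg_shiftS _).
apply: cvg_near_cst; apply: nearW => n.
rewrite /series /= big_mkord big_ord_recl big1 ?addr0 ?expr0 ?fact0 ?divr1 //.
by move=> i _; rewrite exprS !mul0r.
Qed.

Lemma cexp_sum (I : finType) (f : I -> C) : cexp (\sum_i f i) = \prod_i cexp (f i).
Proof. by apply: big_morph; [apply: cexpD | apply: cexp0]. Qed.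

End ComplexExponential.

(** * The matrix exponential *)

Lemma cvg_mxP (K : numFieldType) m n (u : nat -> 'M[K]_(m, n)) (l : 'M[K]_(m, n)) :
  (forall i j, (fun k => u k i j) @ \oo --> l i j) -> u @ \oo --> l.
Proof.
move=> ul A [P lP sPA].
have uP : \forall k \near \oo, forall i j, P i j (u k i j).
  by apply: filter_forall => i; apply: filter_forall => j; apply: ul (lP i j).
by apply: filterS uP => k Pk; apply: sPA.
Qed.

Section MatrixExponential.
Variable R : realType.
Local Notation C := (Cplx R).

Lemma norm_mxX_le d (A : 'M[C]_d) n i j :
  `|(A ^+ n) i j| <= (\sum_p \sum_q `|A p q|) ^+ n.
Proof.
elim: n i j => [|n IHn] i j.
  by rewrite !expr0 mxE; case: eqP => _; rewrite ?normr1 ?normr0.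
rewrite exprS mxE (le_trans (ler_norm_sum _ _ _)) // exprS.
apply: (@le_trans _ _ (\sum_q `|A i q| * (\sum_p \sum_q `|A p q|) ^+ n)).
  by apply: ler_sum => q _; rewrite normrM ler_wpM2l.
rewrite -mulr_suml ler_wpM2r ?exprn_ge0 ?sumr_ge0 // => [p _|].
  by rewrite sumr_ge0.
by rewrite [leRHS](bigD1 i) //= lerDl sumr_ge0 // => p _; rewrite sumr_ge0.
Qed.

(** By [norm_mxX_le] the series of entries converge, and the limit of matrices is then the matrix of
    their limits. *)
Lemma expmx_cvg d (A : 'M[C]_d) i j :
  series (fun n => (A ^+ n) i j / n`!%:R) @ \oo --> expmx A i j.
Proof.
have entry k (p q : 'I_d) : series (fun n => (n`!%:R)^-1 *: (A ^+ n)) k p q =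
    series (fun n => (A ^+ n) p q / n`!%:R) k.
  rewrite /series /= summxE; apply: eq_bigr => n _; by rewrite mxE mulrC.
pose l := \matrix_(p, q) limn (series (fun n => (A ^+ n) p q / n`!%:R)).
have cv p q : series (fun n => (A ^+ n) p q / n`!%:R) @ \oo --> l p q.
  rewrite mxE; have [r _ Sr] := norm_toCE (\sum_p \sum_q `|A p q|).
  apply: (@cvg_cexp_coeff R _ r) => n; rewrite rmorphXn /= -Sr.
  rewrite (le_trans (norm_mxX_le _ _ _ _)) // ger0_norm // sumr_ge0 // => s _.
  by rewrite sumr_ge0.
rewrite (_ : expmx A = l) //; apply/cvg_lim; first exact: norm_hausdorff.
by apply: cvg_mxP => p q; under eq_fun do rewrite entry; apply: cv.
Qed.

Lemma cvg_sum_fin (I : finType) (u : I -> nat -> C) (l : I -> C) :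
  (forall i, u i @ \oo --> l i) -> (fun n => \sum_i u i n) @ \oo --> \sum_i l i.
Proof.
move=> ul; apply: (@cvg_big _ _ +%R); first by move=> x; apply: add_continuous.
by move=> i _; apply: ul.
Qed.

(** The relation passes to powers, then to partial sums, then entry by entry to the limits. *)
Lemma expmx_intertwine m n (P : 'M[C]_(m, n)) (T : 'M[C]_m) (A : 'M[C]_n) :
  T *m P = P *m A -> expmx T *m P = P *m expmx A.
Proof.
move=> TP; have TPX k : T ^+ k *m P = P *m A ^+ k.
  elim: k => [|k IHk]; first by rewrite !expr0 mul1mx mulmx1.
  by rewrite exprSr -mulmxA TP mulmxA IHk -mulmxA exprSr.
apply/matrixP => i j; rewrite !mxE.
have cT : (fun N => \sum_l series (fun n => (T ^+ n) i l / n`!%:R) N * P l j)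
    @ \oo --> \sum_l expmx T i l * P l j.
  by apply: cvg_sum_fin => l; apply: cvgM; [apply: expmx_cvg | apply: cvg_cst].
have cA : (fun N => \sum_l P i l * series (fun n => (A ^+ n) l j / n`!%:R) N)
    @ \oo --> \sum_l P i l * expmx A l j.
  by apply: cvg_sum_fin => l; apply: cvgM; [apply: cvg_cst | apply: expmx_cvg].
apply: (cvg_unique _ cT); first exact: norm_hausdorff.
rewrite (_ : (fun N => _) = (fun N =>
  \sum_l P i l * series (fun n => (A ^+ n) l j / n`!%:R) N)) //.
apply/funext => N; rewrite /series /=.
under eq_bigr do rewrite mulr_suml.
under [RHS]eq_bigr do rewrite mulr_sumr.
rewrite exchange_big [RHS]exchange_big; apply: eq_bigr => k _ /=.
have /matrixP/(_ i j) := TPX k; rewrite !mxE => /(congr1 (fun x => x / k`!%:R)).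
rewrite !mulr_suml => e.
by under eq_bigr do rewrite mulrAC; rewrite e; apply: eq_bigr => l _; rewrite mulrA.
Qed.

Lemma trigmxX d (T : 'M[C]_d) n : is_trig_mx T ->
  is_trig_mx (T ^+ n) /\ forall i, (T ^+ n) i i = T i i ^+ n.
Proof.
move=> /is_trig_mxP Tt; elim: n => [|n [/is_trig_mxP IHt IHd]].
  split=> [|i]; last by rewrite !expr0 mxE eqxx.
  by apply/is_trig_mxP => i j ij; rewrite expr0 mxE -val_eqE ltn_eqF.
split=> [|i].
  apply/is_trig_mxP => i j ij; rewrite exprS mxE big1 // => l _.
  have [il|li] := ltnP i l; first by rewrite Tt // mul0r.
  by rewrite IHt ?mulr0 // (leq_ltn_trans li).
(* Terms with l < i vanish because T^n is triangular, those with l > i because [T] is. *)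
rewrite exprS mxE (bigD1 i) //= big1 ?addr0 ?IHd -?exprS // => l.
rewrite neq_ltn => /orP[li|il]; first by rewrite IHt ?mulr0.
by rewrite Tt ?mul0r.
Qed.

Lemma det_expmx_trig d (T : 'M[C]_d) : is_trig_mx T -> \det (expmx T) = cexp (\tr T).
Proof.
move=> Tt; have TX n := trigmxX n Tt.
have ET i : expmx T i i = cexp (T i i).
  apply: (cvg_unique _ (@expmx_cvg _ T i i)); first exact: norm_hausdorff.
  rewrite (_ : (fun n => _) = fun n => T i i ^+ n / n`!%:R); first exact: cexp_cvg.
  by apply/funext => n; rewrite (TX n).2.
rewrite det_trig; last first.
  apply/is_trig_mxP => i j ij.
  apply: (cvg_unique _ (@expmx_cvg _ T i j)); first exact: norm_hausdorff.
  apply: cvg_near_cst; apply: nearW => N; rewrite /series /= big1 // => n _.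
  by have /is_trig_mxP -> := (TX n).1; rewrite ?mul0r.
by rewrite /mxtrace cexp_sum; apply: eq_bigr => i _.
Qed.

Lemma det_expmx d (A : 'M[C]_d) : \det (expmx A) = cexp (\tr A).
Proof.
(* [Schur] requires a positive size. *)
case: d A => [|d] A.
  by rewrite det_mx00 /mxtrace big_ord0 cexp0.
have [P /unitarymx_unit Pu] := Schur A (ltn0Sn d).
rewrite /similar_to /= conjumx // => Tt.
set T := _ *m _ *m _ in Tt.
(* [T] is triangular and equals P A P^-1; intertwining carries its exponential over to [A]. *)
have TP : T *m P = P *m A by rewrite mulmxKV.
have -> : expmx A = invmx P *m (expmx T *m P).
  by rewrite (expmx_intertwine TP) mulKmx.
rewrite !det_mulmx mulrCA det_inv mulVr -?unitmxE // mulr1 det_expmx_trig //.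
by rewrite /T mxtrace_mulC mulmxA mulVmx // mul1mx.
Qed.

Lemma det2mxE d (T : 'M[C]_d) : det2mx T = cexp (- \tr T) * \det (1%:M + T).
Proof. by rewrite /det2mx det_mulmx det_expmx mulrC raddfN. Qed.
End MatrixExponential.

(** * Operators and their block matrices *)

Section BlockIndex.
Variables (M k : nat).
Local Notation D := (\sum_(n < M) k)%N.

(** All blocks have size [k], so the dependent indices of [tagnat] reduce to plain pairs: [blk]
    flattens a pair, [blk1] and [blk2] recover it. *)
Definition blk (m : 'I_M) (i : 'I_k) : 'I_D := @tagnat.Rank M (fun=> k) m i.
Definition blk1 (r : 'I_D) : 'I_M := @tagnat.sig1 M (fun=> k) r.
Definition blk2 (r : 'I_D) : 'I_k := @tagnat.sig2 M (fun=> k) r.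

Lemma blkK r : blk (blk1 r) (blk2 r) = r.
Proof. exact: tagnat.sig2K. Qed.

Lemma blk1K m i : blk1 (blk m i) = m.
Proof. exact: tagnat.Rank1K. Qed.

Lemma blk2K m i : blk2 (blk m i) = i.
Proof.
exact: (congr1 (fun p : {_ : 'I_M & 'I_k} => projT2 p)
  (@tagnat.rankK M (fun=> k) (existT _ m i))).
Qed.

Lemma sum_blk (V : nmodType) (F : 'I_M -> 'I_k -> V) :
  \sum_r F (blk1 r) (blk2 r) = \sum_m \sum_i F m i.
Proof.
rewrite pair_bigA; apply/esym.
rewrite (reindex (fun r => (blk1 r, blk2 r))) //=.
exists (fun mi => blk mi.1 mi.2) => [r|[m i]] _ /=; first exact: blkK.
by rewrite blk1K blk2K.
Qed.
End BlockIndex.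

Section Operators.
Variables (R : realType) (M k : nat).
Local Notation C := (Cplx R).
Local Notation L := (funsp R M k).
Local Notation D := (\sum_(n < M) k)%N.

(** [coordL] and [funcvL] are inverse linear isomorphisms; through [coordL] an operator becomes
    multiplication by its block matrix ([coordL_app]). *)
Definition coordL (phi : L) : 'cV[C]_D := \col_r phi (blk1 r) (blk2 r) 0.
Definition funcvL (v : 'cV[C]_D) : L := [ffun m => \col_i v (blk m i) 0].

Lemma coordLK : cancel coordL funcvL.
Proof.
by move=> phi; apply/ffunP => m; apply/colP => i; rewrite ffunE !mxE blk1K blk2K.
Qed.

Lemma funcvLK : cancel funcvL coordL.
Proof. by move=> v; apply/colP => r; rewrite mxE ffunE mxE blkK. Qed.

Lemma coordL_linear : linear coordL.
Proof. by move=> a phi psi; apply/colP => r; rewrite !mxE !ffunE !mxE. Qed.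
HB.instance Definition _ := GRing.isLinear.Build _ _ _ _ coordL coordL_linear.

Lemma funcvL_linear : linear funcvL.
Proof. by move=> a u v; apply/ffunP => m; apply/colP => i; rewrite !(ffunE, mxE). Qed.
HB.instance Definition _ := GRing.isLinear.Build _ _ _ _ funcvL funcvL_linear.

(** Basis vectors have entries 0 and 1, fixed by conjugation, so the inner product reads off one
    coordinate. *)
Lemma blockE (K : 'End(L)) n m i j : block K n m i j = (K (basisL R m j) : L) n i 0.
Proof.
rewrite mxE /dotL (bigD1 n) //= [X in _ + X]big1 ?addr0 => [|l nl]; last first.
  rewrite /dotC big1 // => p _.
  by rewrite ffunE eq_sym (negPf nl) scale0r mxE conjC0 mul0r.
rewrite /dotC (bigD1 i) //= [X in _ + X]big1 ?addr0 => [|p ni]; last first.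
  by rewrite ffunE eqxx scale1r mxE (negPf ni) conjC0 mul0r.
by rewrite ffunE eqxx scale1r mxE !eqxx conjC1 mul1r.
Qed.

Lemma blockmxE (K : 'End(L)) r s :
  blockmx K r s = block K (blk1 r) (blk1 s) (blk2 r) (blk2 s).
Proof. by rewrite mxE. Qed.

Lemma funL_basis (phi : L) : phi = \sum_m \sum_j phi m j 0 *: basisL R m j.
Proof.
apply/ffunP => l; apply/colP => i.
rewrite sum_ffunE summxE (bigD1 l) //= [X in _ + X]big1 ?addr0 => [|m nml]; last first.
  rewrite sum_ffunE summxE big1 // => j _.
  by rewrite !ffunE (negPf nml) scale0r scaler0 mxE.
rewrite sum_ffunE summxE (bigD1 i) //= [X in _ + X]big1 ?addr0 => [|j nji].
  by rewrite !ffunE eqxx scale1r !mxE !eqxx mulr1.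
by rewrite !ffunE eqxx scale1r !mxE eq_sym (negPf nji) mulr0.
Qed.

Lemma coordL_app (K : 'End(L)) phi : coordL (K phi) = blockmx K *m coordL phi.
Proof.
apply/colP => r; rewrite !mxE.
under eq_bigr do rewrite blockmxE blockE mxE.
rewrite (sum_blk (fun m j => (K (basisL R m j) : L) (blk1 r) (blk2 r) 0 * phi m j 0)).
rewrite {1}[phi]funL_basis linear_sum sum_ffunE summxE; apply: eq_bigr => m _.
rewrite linear_sum sum_ffunE summxE; apply: eq_bigr => j _.
by rewrite linearZ ffunE mxE mulrC.
Qed.

Lemma blockmxP (K : 'End(L)) (X : 'M[C]_D) :
  (forall phi, coordL (K phi) = X *m coordL phi) -> blockmx K = X.
Proof.
move=> KX; apply/matrixP => r s.
have := coordL_app K (funcvL (delta_mx s 0)).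
by rewrite KX funcvLK -!colE => /colP/(_ r); rewrite !mxE.
Qed.

Lemma blockmxZ z (K : 'End(L)) : blockmx (z *: K) = z *: blockmx K.
Proof.
by apply: blockmxP => phi; rewrite scale_lfunE linearZ /= coordL_app scalemxAl.
Qed.

Lemma coordL_iter (T : 'End(L)) n phi :
  coordL (iter n T phi) = blockmx T ^+ n *m coordL phi.
Proof.
elim: n => [|n IHn]; first by rewrite expr0 mul1mx.
by rewrite iterS coordL_app IHn mulmxA exprS.
Qed.

Lemma coordL_expop (T : 'End(L)) phi :
  coordL (expop T phi) = expmx (blockmx T) *m coordL phi.
Proof.
(* [linfun] accepts any function, but [lfunE] needs a linear one; the pointwise limit is therefore
   first identified with a composite of linear maps. *)
suff -> : expop T = linfun (funcvL \o mulmx (expmx (blockmx T)) \o coordL).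
  by rewrite lfunE /= funcvLK.
congr linfun; apply/funext => psi; apply/ffunP => m; rewrite /= !ffunE.
apply: (@cvg_lim _ (@norm_hausdorff _ 'cV[C]_k)).
apply: cvg_mxP => i j; rewrite ord1 !mxE.
pose u s N :=
  series (fun n => (blockmx T ^+ n) (blk m i) s / n`!%:R) N * coordL psi s 0.
have cv : (fun N => \sum_s u s N) @ \oo -->
    \sum_s expmx (blockmx T) (blk m i) s * coordL psi s 0.
  by apply: cvg_sum_fin => s; apply: cvgM; [apply: expmx_cvg | apply: cvg_cst].
rewrite (_ : (fun N => _) = fun N => \sum_s u s N) //.
apply/funext => N; rewrite /u /series /= summxE.
under [RHS]eq_bigr do rewrite mulr_suml.
rewrite [RHS]exchange_big; apply: eq_bigr => n _ /=.
have /colP/(_ (blk m i)) := coordL_iter T n psi.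
rewrite !mxE blk1K blk2K => ->; rewrite mulr_sumr; apply: eq_bigr => s _.
by rewrite mulrA [_ / _]mulrC.
Qed.

(** Meant for the dimension of [{:L}] and the block matrix size, which are equal but not
    convertible. Each one-sided inverse gives one inequality between the sizes. *)
Lemma det_rect_conj (F : fieldType) m n (P : 'M[F]_(m, n))
    (Q : 'M[F]_(n, m)) (X : 'M[F]_n) :
  P *m Q = 1%:M -> Q *m P = 1%:M -> \det (P *m X *m Q) = \det X.
Proof.
move=> PQ QP; have eq_mn : m = n.
  by apply/eqP; rewrite eqn_leq (mulmx1_min PQ) (mulmx1_min QP).
by subst n; rewrite !det_mulmx mulrAC -det_mulmx PQ det1 mul1r.
Qed.

Import passmx.

Lemma det1op_blockmx (A : 'End(L)) : det1op A = \det (blockmx A).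
Proof.
have bas := vbasisP {:L}; set e := vbasis _ in bas *; rewrite /det1op -/e.
(* [P] sends row coordinates in the basis [e] to transposed [coordL] coordinates; [Q] goes back. *)
pose P := lin1_mx (trmx \o coordL \o vecof e).
pose Q := lin1_mx (rVof e \o funcvL \o trmx).
have PQ : P *m Q = 1%:M.
  apply/row_matrixP => i; rewrite !rowE mulmx1 mulmxA /P /Q !mul_rV_lin1 /=.
  by rewrite trmxK coordLK vecofK.
have QP : Q *m P = 1%:M.
  apply/row_matrixP => i; rewrite !rowE mulmx1 mulmxA /P /Q !mul_rV_lin1 /=.
  by rewrite rVofK // funcvLK trmxK.
rewrite -[RHS]det_tr -(det_rect_conj _ PQ QP); congr (\det _).
(* [mxof] acts on row vectors from the right, hence the transpose. *)
suff NP : mxof e e A *m P = P *m (blockmx A)^T by rewrite -NP -mulmxA PQ mulmx1.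
apply/row_matrixP => i; rewrite !rowE !mulmxA mul_mxof /P !mul_rV_lin1 /=.
by rewrite rVofK // coordL_app trmx_mul.
Qed.

Lemma det2opE (T : 'End(L)) : det2op T = det2mx (blockmx T).
Proof.
rewrite /det2op det1op_blockmx; congr (\det _); apply: blockmxP => phi.
rewrite comp_lfunE add_lfunE id_lfunE linearD /= (coordL_app T) !coordL_expop.
by rewrite -scaleN1r blockmxZ scaleN1r -mulmxA mulmxDl mul1mx.
Qed.

(** The tuples [j] and [m] together are one tuple of flat indices, and with s = n every diagonal
    entry is zeroed. *)
Lemma sum_Ktilde (K : 'End(L)) n :
  \sum_(j : n.-tuple 'I_k) \sum_(m : n.-tuple 'I_M) Ktilde K j m =
  hollow_sum (blockmx K) n n.
Proof.
rewrite pair_bigA (reindex (fun f : {ffun 'I_n -> 'I_D} =>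
  ([tuple blk2 (f a) | a < n], [tuple blk1 (f a) | a < n]))) /=.
  apply: eq_bigr => f _; congr (\det _); apply/matrixP => a b.
  by rewrite [LHS]mxE [RHS]mxE !tnth_mktuple blockmxE ltn_ord andbT.
exists (fun jm : n.-tuple 'I_k * n.-tuple 'I_M =>
  [ffun a => blk (tnth jm.2 a) (tnth jm.1 a)]) => [f|[j m]] _ /=.
  by apply/ffunP => a; rewrite ffunE !tnth_mktuple blkK.
by congr pair; apply: eq_from_tnth => a; rewrite tnth_mktuple ffunE ?blk1K ?blk2K.
Qed.
End Operators.

(** * The series *)

Section Series.
Variable R : realType.
Local Notation C := (Cplx R).

Lemma cvg_series_cauchy_exp (c : nat -> C) d (x : C) :
  (forall p, (d < p)%N -> c p = 0) ->
  series (fun n => \sum_(i < n.+1) c i * (x ^+ (n - i) / (n - i)`!%:R)) @ \oo -->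
  (\sum_(i < d.+1) c i) * cexp x.
Proof.
(* Starting at [d.+1] terms, each i <= d contributes [c i] times an exponential partial sum of n +
   (d + 1 - i) terms, without truncated subtraction. *)
move=> c0; rewrite -(cvg_shiftn d.+1) mulr_suml.
rewrite (_ : (fun n => _) = fun n => \sum_(i < d.+1) c i *
    series (fun n => x ^+ n / n`!%:R) (n + (d.+1 - i))%N); last first.
  apply/funext => n; rewrite /series /= big_mkord.
  rewrite (big_cauchy_triangle _ (fun i j => c i * (x ^+ j / j`!%:R))).
  under [RHS]eq_bigr => i _ do rewrite big_mkord mulr_sumr addnBA 1?ltnW //.
  rewrite [RHS](big_ord_widen (n + d.+1) (fun i =>
    \sum_(j < n + d.+1 - i) c i * (x ^+ j / j`!%:R))) ?leq_addl //.
  rewrite [RHS]big_mkcond; apply: eq_bigr => i _; case: ltnP => // lt_di.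
  by rewrite big1 // => j _; rewrite c0 ?mul0r.
apply: cvg_sum_fin => i; apply: cvgM; first exact: cvg_cst.
by rewrite (cvg_shiftn _ (series _)); apply: cexp_cvg.
Qed.

Lemma cvg_series_hollow_sum d (A : 'M[C]_d) z :
  series (fun n => z ^+ n / n`!%:R * hollow_sum A n n) @ \oo -->
  \det (1%:M + z *: A) * cexp (- z * \tr A).
Proof.
pose c p := z ^+ p * \sum_(S : {set 'I_d} | #|S| == p) pminor S A.
have c0 p : (d < p)%N -> c p = 0.
  move=> dp; rewrite /c big1 ?mulr0 // => S /eqP cS.
  by have := max_card (mem S); rewrite card_ord cS leqNgt dp.
rewrite det1DZ (_ : (fun n => _) = fun n => \sum_(i < n.+1) c i *
   ((- z * \tr A) ^+ (n - i) / (n - i)`!%:R)); first exact: cvg_series_cauchy_exp.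
(* Reversal makes [i] the size of the minors instead of the exponent of the trace; then 'C(n, i) i!
   / n! = 1 / (n - i)!. *)
apply/funext => n; rewrite hollow_sumE // (reindex_inj rev_ord_inj) mulr_sumr.
apply: eq_bigr => i _ /=; rewrite subSS minor_sumE.
have le_in : (i <= n)%N by rewrite -ltnS.
rewrite subKn // bin_sub // /c -/(\tr A); set e := \sum_(S | _) _.
have nz j : j`!%:R != 0 :> C by rewrite pnatr_eq0 -lt0n fact_gt0.
have nzb : 'C(n, i)%:R != 0 :> C by rewrite pnatr_eq0 -lt0n bin_gt0.
rewrite mulNr -mulrN exprMn -{1}(subnKC le_in) exprD.
rewrite -mulr_natr -[e *+ _]mulr_natr -(bin_fact le_in) !natrM.
by field; rewrite !nz nzb.
Qed.
End Series.

Theorem theorem4p2 (R : realType) (M k : nat) (hM : (1 <= M)%N) (hk : (1 <= k)%N)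
    (K : 'End(funsp R M k)) (z : Cplx R) :
  [/\ det2op (z *: K) = det2mx (z *: blockmx K),
      det2mx (z *: blockmx K) =
        cexp (- z * \tr (blockmx K)) * \det (1%:M + z *: blockmx K)
    & series (fun n : nat => z ^+ n / n`!%:R *
        (\sum_(j : n.-tuple 'I_k) \sum_(m : n.-tuple 'I_M) Ktilde K j m))
      @ \oo --> det2mx (z *: blockmx K) ].
Proof.
have det2E : det2mx (z *: blockmx K) =
    cexp (- z * \tr (blockmx K)) * \det (1%:M + z *: blockmx K).
  by rewrite det2mxE mxtraceZ mulNr.
split=> //; first by rewrite det2opE blockmxZ.
under eq_fun do rewrite sum_Ktilde.
by rewrite det2E mulrC; apply: cvg_series_hollow_sum.
Qed.
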